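(* Let $J$ be an $n$-dimensional Jordan algebra over a field $K$ with non-trivial centre $Z(J)\neq\{0\}$. Then $J$ is a central extension of a Jordan algebra of lower dimension.
   Context: A Jordan algebra over a field $K$ is a $K$-vector space $J$ with a symmetric bilinear product $\circ$ satisfying $x^2\circ(x\circ y)=x\circ(x^2\circ y)$ for all $x,y\in J$, where $x^2=x\circ x$. Its centre is $Z(J)=\{x\in J: x\circ y=0\ \forall y\in J\}$. A sequence of Jordan algebras $L\xrightarrow{\epsilon}J\xrightarrow{\lambda}M$, with $\epsilon$ an injective and $\lambda$ a surjective Jordan algebra homomorphism and $\operatorname{im}\epsilon=\ker\lambda$, is called an extension of $M$ by $L$ (and $J$ itself is called an extension of $M$ by $L$); it is central if $\ker\lambda\subseteq Z(J)$. *)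

(* Defs.v *)
(* MathComp, with the sets of mathcomp-classical. *)
From HB Require Import structures.
From mathcomp Require Import all_boot all_order all_algebra.
From mathcomp Require Import sesquilinear classical_sets.

Set Implicit Arguments.
Unset Strict Implicit.
Unset Printing Implicit Defensive.

Import GRing.Theory.
Local Open Scope ring_scope.
Local Open Scope classical_set_scope.

Reserved Notation "x *j y" (at level 40, left associativity).

(* The characteristic of K is arbitrary, and J need not be finite-dimensional:
   that is added in findim_jordanType. *)
HB.mixin Record isJordan (K : fieldType) J of GRing.Lmodule K J := {
  jmul : J -> J -> J ;
  jmul_bilinear : bilinear_for *:%R *:%R jmul ;
  jmulC : forall x y : J, jmul x y = jmul y x ;
  jmul_jordan : forall x y : J,
    jmul (jmul x x) (jmul x y) = jmul x (jmul (jmul x x) y)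
}.

#[short(type="jordanType")]
HB.structure Definition Jordan (K : fieldType) :=
  { J of GRing.Lmodule K J & isJordan K J }.

#[short(type="findim_jordanType")]
HB.structure Definition FinDimJordan (K : fieldType) :=
  { J of Vector K J & isJordan K J }.

Notation "x *j y" := (jmul x y) : ring_scope.

(* The annihilator of J, which is what "centre" means here. *)
Definition jcenter (K : fieldType) (J : jordanType K) : set J :=
  [set x | forall y : J, x *j y = 0].
Arguments jcenter {K} J _.

Definition jordan_hom (K : fieldType) (J M : jordanType K)
    (f : {linear J -> M}) : Prop :=
  {morph f : x y / x *j y}.

Definition jkernel (K : fieldType) (J M : jordanType K)
    (f : {linear J -> M}) : set J :=
  [set x | f x = 0].

Definition is_extension (K : fieldType) (L J M : jordanType K)
    (eps : {linear L -> J}) (lam : {linear J -> M}) : Prop :=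
  [/\ jordan_hom eps /\ injective eps,
      jordan_hom lam /\ (forall z : M, exists x : J, lam x = z) &
      range eps = jkernel lam].

Definition is_central_extension (K : fieldType) (L J M : jordanType K)
    (eps : {linear L -> J}) (lam : {linear J -> M}) : Prop :=
  is_extension eps lam /\ jkernel lam `<=` jcenter J.

Definition central_extension_of (K : fieldType) (J M : jordanType K) : Prop :=
  exists (L : jordanType K) (eps : {linear L -> J}) (lam : {linear J -> M}),
    is_central_extension eps lam.

(* Main.v *)
(* Split J as a vector space into a line <[z]> spanned by a nonzero central
   element and a complement.  Multiplying in the complement and projecting back
   along <[z]> is a model of J / <[z]>, since products in J do not see central
   summands. *)
Require Import Defs.
From HB Require Import structures.
From mathcomp Require Import all_boot all_order all_algebra.
From mathcomp Require Import sesquilinear boolp classical_sets.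

Set Implicit Arguments.
Unset Strict Implicit.
Unset Printing Implicit Defensive.

Import GRing.Theory.
Local Open Scope ring_scope.
Local Open Scope classical_set_scope.

HB.instance Definition _ (K : fieldType) (J : jordanType K) :=
  bilinear_isBilinear.Build K J J J *:%R *:%R (@jmul K J) jmul_bilinear.

Section NullJordan.
Variables (K : fieldType) (V : lmodType K).

(** The kernel of a central extension multiplies to zero, so this serves as L; the alias keeps the
    zero product off [V] itself. *)
Definition null_jordan : Type := V.
HB.instance Definition _ := GRing.Lmodule.on null_jordan.

Definition null_mul (x y : null_jordan) : null_jordan := 0.

Fact null_mul_bilinear : bilinear_for *:%R *:%R null_mul.
Proof. by split=> u a x y; rewrite /null_mul /= scaler0 addr0. Qed.

HB.instance Definition _ := isJordan.Build K null_jordan null_mul_bilinear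
  (fun _ _ => erefl) (fun _ _ => erefl).

End NullJordan.

Section CentralQuotient.
Variables (K : fieldType) (J : findim_jordanType K) (U : {vspace J}).
Hypothesis centralU : [set` U] `<=` jcenter J.

(* The proof argument is a tag: the Jordan structure attached to this alias is
   only valid when U is central. *)
Definition central_quotient (_ : [set` U] `<=` jcenter J) : Type :=
  subvs_of (U^C)%VS.
Local Notation M := (central_quotient centralU).
HB.instance Definition _ := Vector.on M.

Definition quotient_map : J -> M := vsproj (U^C)%VS \o daddv_pi (U^C)%VS U.
HB.instance Definition _ := GRing.Linear.on quotient_map.

Definition quotient_lift : M -> J := vsval.
HB.instance Definition _ := GRing.Linear.on quotient_lift.

(** [projv U] projects along the same complement [U^C], so the two projections sum to the
    identity. *)
Lemma quotient_mapK x : quotient_lift (quotient_map x) = x - projv U x.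
Proof.
rewrite /quotient_lift /quotient_map /= vsprojK ?memv_pi //.
have xV : x \in (U + U^C)%VS by rewrite addv_complf memvf.
by rewrite -[X in X - _](daddv_pi_add (capv_compl U) xV) addrC addKr.
Qed.

Lemma quotient_liftK : cancel quotient_lift quotient_map.
Proof.
move=> w; rewrite /quotient_map /= daddv_pi_id ?subvsP ?vsvalK //.
by rewrite capvC capv_compl.
Qed.

Lemma quotient_map_eq0 x : (quotient_map x == 0) = (x \in U).
Proof.
apply/eqP/idP => [x0 | xU].
  have := quotient_mapK x; rewrite x0 linear0 => /esym/subr0_eq->.
  exact: memv_pi.
(* Lifting and mapping once more changes nothing in [M], but replaces x by [x - projv U x], which is
   0 for x in [U]. *)
by rewrite -[LHS]quotient_liftK quotient_mapK projv_id // subrr linear0.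
Qed.

Definition quotient_mul (a b : M) : M :=
  quotient_map (quotient_lift a *j quotient_lift b).

(** The lifts differ from x and y only by components in [U], which annihilate [J] by centrality. *)
Lemma quotient_map_mul x y :
  quotient_map (x *j y) = quotient_mul (quotient_map x) (quotient_map y).
Proof.
have pC v w : projv U v *j w = 0 by apply: centralU; apply: memv_pi.
rewrite /quotient_mul !quotient_mapK linearBl linearBr /= pC subr0.
by rewrite (jmulC x (projv U y)) pC subr0.
Qed.

Fact quotient_mul_bilinear : bilinear_for *:%R *:%R quotient_mul.
Proof.
split=> u a x y; rewrite /quotient_mul !linearP /=.
  by rewrite linearPl linearP.
by rewrite linearPr linearP.
Qed.

Fact quotient_mulC a b : quotient_mul a b = quotient_mul b a.
Proof. by rewrite /quotient_mul jmulC. Qed.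

Fact quotient_mul_jordan a b :
  quotient_mul (quotient_mul a a) (quotient_mul a b) =
  quotient_mul a (quotient_mul (quotient_mul a a) b).
Proof.
(* Once a and b are written as images of their lifts, both sides become images of products in
   [J]. *)
rewrite -(quotient_liftK a) -(quotient_liftK b) -!quotient_map_mul.
by rewrite jmul_jordan.
Qed.

HB.instance Definition _ := isJordan.Build K M
  quotient_mul_bilinear quotient_mulC quotient_mul_jordan.

Lemma dim_central_quotient : (\dim {: M} = \dim {: J} - \dim U)%N.
Proof. by rewrite dimvf -dimv_compl. Qed.

Definition subvs_incl : null_jordan (subvs_of U) -> J := vsval.
HB.instance Definition _ := GRing.Linear.on subvs_incl.

Lemma central_quotient_extension :
  is_central_extension (subvs_incl : {linear _ -> J})
    (quotient_map : {linear J -> M}).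
Proof.
have kerE x : jkernel (quotient_map : {linear J -> M}) x <-> x \in U.
  by rewrite -quotient_map_eq0; split=> [/eqP|/eqP].
split; last by move=> x /kerE; apply: centralU.
split.
- split; last exact: subvs_inj.
  (* Both sides vanish: the source has zero product, and the image of x is central. *)
  by move=> x y; rewrite [LHS]linear0 [RHS](centralU (subvsP x)).
- split; first exact: quotient_map_mul.
  by move=> w; exists (quotient_lift w); apply: quotient_liftK.
apply/seteqP; split=> [_ [u _ <-] | x /kerE xU]; first exact/kerE/subvsP.
by exists (Subvs xU).
Qed.

End CentralQuotient.

Lemma jcenter_line (K : fieldType) (J : findim_jordanType K) (z : J) :
  jcenter J z -> [set` <[z]>%VS] `<=` jcenter J.
Proof. by move=> zZ _ /vlineP[a ->] y; rewrite linearZl_LR /= zZ scaler0. Qed.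

Theorem lemma20 (K : fieldType) (n : nat) (J : findim_jordanType K)
    (dimJ : \dim {: J} = n) (ntZ : jcenter J <> [set 0]) :
  exists M : findim_jordanType K,
    (\dim {: M} < n)%N /\ central_extension_of J M.
Proof.
have [z zZ z_neq0] : exists2 z, jcenter J z & z != 0.
  (* [ntZ] only denies an equality of sets, so the nonzero witness is obtained classically; 0 is
     always central. *)
  apply: contrapT => noz; apply: ntZ; apply/seteqP; split=> [z zZ | _ -> y].
    by apply: contrapT => /eqP z_neq0; apply: noz; exists z.
  exact: linear0l.
exists (central_quotient (jcenter_line zZ)); split; last first.
  by do 3 eexists; apply: central_quotient_extension.
have dimz : \dim <[z]>%VS = 1%N by rewrite dim_vline z_neq0.
rewrite dim_central_quotient dimJ dimz ltn_subrL -dimJ /=.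
(* Truncated subtraction decreases strictly only if [J] has positive dimension, which the line
   [<[z]>] inside it ensures. *)
by rewrite -dimz dimvS ?subvf.
Qed.
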